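(* Let $n\ge 6$ be an integer and let $m^*=\lfloor (n-1)/4\rfloor$. Then the sequence $\{A(n,m)\}_{m=0}^{n-2}$ is strongly unimodal with mode $m^*$, that is, \[ A(n,0)<A(n,1)<\dots<A(n,m^* )>A(n,m^*+1)>A(n,m^*+2)>\dots>A(n,n-2). \]
   Context: For $n\ge 1$, let $\mathcal H_n$ be the set of integer partitions $\lambda=\lambda_1\lambda_2\cdots$ (written with positive parts in weakly decreasing order) whose largest hook length is $n$; equivalently, $\lambda_1+\ell(\lambda)-1=n$, where $\ell(\lambda)$ is the number of parts. $A(n,m)$ denotes the number of partitions in $\mathcal H_n$ with exactly $m$ even parts (counted with multiplicity). Equivalently (a known fact recalled in the paper), $A(n,m)=\sum_{k}\binom{k}{m}\binom{n-1-k}{k-m}$, where $\binom{a}{b}=0$ unless $0\le b\le a$; these numbers satisfy $A(n,m)=A(n-1,m)+A(n-1,m-1)+A(n-2,m)-A(n-2,m-1)$ for $n\ge 2$, with $A(0,0)=0$ and $A(1,0)=1$ (all other values $A(0,m)$ and $A(1,m)$ being $0$). *)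

(* Defs.v *)
From mathcomp Require Import all_boot.
Set Implicit Arguments.
Unset Strict Implicit.
Unset Printing Implicit Defensive.

Definition is_partition (la : seq nat) : bool :=
  sorted geq la && all (leq 1) la.

(* Rows and columns are numbered from 0, so the cells of [la] are the (i, j)
   with i < size la and j < la_i, and the conjugate part la'_j is the number of
   parts larger than j. *)
Definition arm (la : seq nat) (i j : nat) : nat := nth 0 la i - j.+1.
Definition leg (la : seq nat) (i j : nat) : nat := count (ltn j) la - i.+1.
Definition hook_length (la : seq nat) (i j : nat) : nat :=
  (arm la i j + leg la i j).+1.

Definition largest_hook (la : seq nat) : nat :=
  \max_(i < size la) \max_(j < nth 0 la i) hook_length la i j.

(* The empty partition has no hook, hence lies in no H_n. *)
Definition in_H (n : nat) (la : seq nat) : bool :=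
  [&& is_partition la, la != [::] & largest_hook la == n].

Definition num_even_parts (la : seq nat) : nat :=
  count (fun p => ~~ odd p) la.

(* A partition whose largest hook length is n has at most n parts, each at most
   n (see [in_H_bound]), so H_n can be counted inside the finite type of
   sequences of length at most n over {0, ..., n}; [A_size] shows that nothing
   is lost. *)
Definition A (n m : nat) : nat :=
  #|[set s : n.-bseq 'I_n.+1 |
      let la := [seq val x | x <- s] in
      in_H n la && (num_even_parts la == m)]|.

(* a_0 < a_1 < ... < a_k > a_{k+1} > ... > a_N *)
Definition strongly_unimodal (a : nat -> nat) (N k : nat) : Prop :=
  [/\ k <= N,
      forall i, i < k -> a i < a i.+1 &
      forall i, k <= i -> i < N -> a i.+1 < a i].

Lemma in_H_corner n la : in_H n la -> head 0 la + size la <= n.+1.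
Proof.
case: la => [|p la]; first by rewrite /in_H andbF.
case/and3P=> /andP[_ pos] _ /eqP <- /=.
have p_gt0 : 0 < p by case/andP: pos.
have := @leq_bigmax _ (fun i : 'I_(size (p :: la)) =>
  \max_(j < nth 0 (p :: la) i) hook_length (p :: la) i j) ord0.
have := @leq_bigmax _ (fun j : 'I_p =>
  hook_length (p :: la) 0 j) (Ordinal p_gt0).
move=> h1 h2; have := leq_trans h1 h2; rewrite -/(largest_hook _).
rewrite /hook_length /arm /leg /=.
have -> : count (ltn 0) la = size la by apply/eqP; rewrite -all_count; case/andP: pos.
rewrite p_gt0 add1n subSS subn0 subn1 => h.
by rewrite addnS ltnS -{1}(prednK p_gt0).
Qed.

Lemma in_H_bound n la : in_H n la -> size la <= n /\ all (fun p => p <= n) la.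
Proof.
case: la => [|p la] H; first by move: H; rewrite /in_H andbF.
have /= := in_H_corner H; case/and3P: H => /andP[/= srt /andP[p_gt0 _]] _ _.
move=> h; split; first by rewrite -ltnS (leq_trans _ h) // -add1n leq_add2r.
have le_pn : p <= n by rewrite -ltnS (leq_trans _ h) // addnS ltnS leq_addr.
rewrite le_pn /=; apply/allP => q q_la; apply: leq_trans le_pn.
have geq_trans : transitive geq by move=> x y z yx xz; apply: leq_trans xz yx.
exact: (allP (order_path_min geq_trans srt)).
Qed.

Lemma A_size n m (r : seq (seq nat)) :
    uniq r ->
    (forall la, (la \in r) = in_H n la && (num_even_parts la == m)) ->
  A n m = size r.
Proof.
move=> r_uniq rP; rewrite /A cardE.
pose f (s : n.-bseq 'I_n.+1) := [seq val x | x <- s].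
rewrite -(size_map f); apply: perm_size; apply: uniq_perm => //.
  by rewrite map_inj_uniq ?enum_uniq // => s t /(inj_map val_inj)/val_inj.
move=> la; rewrite rP; apply/mapP/idP => [[s]|H].
  by rewrite mem_enum inE => h ->.
have /andP[/in_H_bound[sz /allP le_n] _] := H.
have sz' : size [seq inord x : 'I_n.+1 | x <- la] <= n by rewrite size_map.
have Ela : la = f (Bseq sz').
  rewrite /f /= -map_comp -[LHS]map_id; apply/eq_in_map => x /le_n xn /=.
  by rewrite inordK.
by exists (Bseq sz') => //; rewrite mem_enum inE -/(f _) -Ela.
Qed.

(* Main.v *)
Require Import Defs.
From mathcomp Require Import all_boot.
From mathcomp Require Import all_order all_algebra zify ring lra.

(** Duplicating the largest part, or adding one to it, produces each partition
of H_(n+1) exactly once from those of H_n; following the parity of the largest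
part gives the recurrence of A, hence A(n, k) = sum_j C(k+j, j) C(M-j, j) with
M = n - 1 - k. Then, with x = k,

  A(n, k) - A(n, k+1) = sum_j (3j + 1 - M) C(M-j, j)/(j+1) w_x(j),
  w_x(j) = prod_(i < j) (x+i+2)/(i+1).

The right-hand side makes sense for every rational x > -2, and its sign is
monotone in x, since the coefficients 3j + 1 - M change sign once and
w_y(j)/w_x(j) increases with j when y > x. So it suffices to find it positive
at x = (M-3)/3 and negative at x = (M-4)/3. There the summand equals, up to a
positive factor, a hypergeometric term times a polynomial of constant sign,
plus a telescoping difference of the kind produced by Gosper's algorithm. *)

Import Order.TTheory GRing.Theory Num.Theory.

Require Import Defs.

(** * Generating the partitions of each hook length from the previous ones *)

Lemma largest_hook_cons p la :
  is_partition (p :: la) -> largest_hook (p :: la) = p + size la.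
Proof.
move=> part; apply/eqP; rewrite eqn_leq; apply/andP; split; last first.
  (* The corner hook bounds the maximum from below. For the upper bound, no row is longer than p and
     no column longer than the number of parts. *)
  have /in_H_corner : in_H (largest_hook (p :: la)) (p :: la).
    by rewrite /in_H part eqxx.
  by rewrite /= addnS ltnS.
have geq_trans : transitive geq by move=> x y z yx xz; apply: leq_trans xz yx.
have le_p i : nth 0 (p :: la) i <= p.
  case: i => [//|i] /=; have [lt_i|/(nth_default 0)->//] := ltnP i (size la).
  case/andP: part => /= /(order_path_min geq_trans)/allP le_p _.
  by apply: le_p; rewrite mem_nth.
apply/bigmax_leqP => i _; apply/bigmax_leqP => j _.
have := le_p i; have := ltn_ord j; have := ltn_ord i.
have := count_size (ltn j) (p :: la).
by rewrite /hook_length /arm /leg /=; lia.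
Qed.

Lemma in_H_cons n p la :
  in_H n (p :: la) = is_partition (p :: la) && (p + size la == n).
Proof.
rewrite /in_H; case part: (is_partition _) => //.
by rewrite largest_hook_cons.
Qed.

(** Repeating the first row lengthens the leg of the corner cell by one, and [bump_head] lengthens
    its arm by one. The images are disjoint: the two largest parts are equal exactly after a
    repetition. *)
Definition dup_head (la : seq nat) : seq nat :=
  if la is p :: q then [:: p, p & q] else la.

Definition bump_head (la : seq nat) : seq nat :=
  if la is p :: q then p.+1 :: q else la.

Fixpoint hook_enum (n : nat) : seq (seq nat) :=
  match n with
  | 0 => [::]
  | 1 => [:: [:: 1]]
  | n'.+1 => map dup_head (hook_enum n') ++ map bump_head (hook_enum n')
  end.

Lemma hook_enumSS n :
  hook_enum n.+2 =
    map dup_head (hook_enum n.+1) ++ map bump_head (hook_enum n.+1).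
Proof. by []. Qed.

Lemma mem_hook_enum n la : (la \in hook_enum n) = in_H n la.
Proof.
elim: n la => [|[|n] IHn] la.
- case: la => [|p la]; first by rewrite /in_H.
  rewrite in_H_cons in_nil; case: p => [|p]; last by rewrite addSn andbF.
  by rewrite /is_partition /= andbF.
- case: la => [|p la]; first by rewrite /in_H.
  rewrite in_H_cons inE; case: p => [|[|p]]; first by rewrite /is_partition !andbF.
    by case: la => [|q la]; rewrite /is_partition //= add1n andbF.
  by rewrite !addSn !eqSS andbF.
rewrite hook_enumSS mem_cat; apply/orP/idP => [[]|].
- case/mapP=> -[|p q]; rewrite IHn; first by rewrite /in_H.
  rewrite !in_H_cons /is_partition => /andP[/andP[/= pq /andP[p0 q0]] sz] ->.
  rewrite in_H_cons /is_partition /= leqnn pq p0 q0 /=; lia.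
- case/mapP=> -[|p q]; rewrite IHn; first by rewrite /in_H.
  rewrite !in_H_cons /is_partition => /andP[/andP[/= pq /andP[p0 q0]] sz] ->.
  rewrite in_H_cons /is_partition /= q0 addSn eqSS sz !andbT.
  by case: q pq q0 sz => [//|r q] /= /andP[rp ->] _ _; rewrite (leq_trans rp).
case: la => [|p [|r q]]; first by rewrite /in_H.
  rewrite in_H_cons /is_partition /= !andbT addn0 => /andP[p0 /eqP ->]; right.
  by apply/mapP; exists [:: n.+1]; rewrite // IHn in_H_cons /is_partition /= addn0 eqxx.
rewrite in_H_cons /is_partition /= => /andP[/andP[/andP[rp rq] /and3P[p0 r0 q0]] sz].
(* The preimage depends on the two largest parts: if they differ, lower the first; if they agree,
   delete one copy. *)
have [lt_rp|le_pr] := ltnP r p.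
  right; apply/mapP; exists [:: p.-1, r & q]; last by rewrite /= prednK.
  by rewrite IHn in_H_cons /is_partition /= rq r0 q0; lia.
have def_p : p = r by apply/eqP; rewrite eqn_leq le_pr rp.
left; apply/mapP; exists (r :: q); last by rewrite def_p.
by rewrite IHn in_H_cons /is_partition /= rq r0 q0; lia.
Qed.

Lemma nil_notin_hook_enum n : [::] \notin hook_enum n.
Proof. by rewrite mem_hook_enum /in_H. Qed.

Lemma hook_enum_uniq n : uniq (hook_enum n).
Proof.
elim: n => [|[|n] IHn] //; rewrite hook_enumSS cat_uniq.
have inj f : {in predC1 [::] &, injective f} -> uniq (map f (hook_enum n.+1)).
  move=> f_inj; rewrite map_inj_in_uniq // => la lb la_n lb_n.
  by apply: f_inj; rewrite inE; apply: contraNneq (nil_notin_hook_enum n.+1) => <-.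
apply/and3P; split.
- by apply: inj => -[|p q] [|p' q'] //= _ _ [_ -> ->].
- apply/hasPn => la /mapP[[|p q]]; first by rewrite (negPf (nil_notin_hook_enum _)).
  rewrite mem_hook_enum in_H_cons /is_partition => /andP[/andP[/= pq _] _] ->.
  apply/mapP=> -[[|r s] _ //= [def_r def_q]].
  by move: pq; rewrite def_q -def_r /= ltnn.
- by apply: inj => -[|p q] [|p' q'] //= _ _ [-> ->].
Qed.

(** * The recurrence for A *)

Definition count_even (n m : nat) : nat :=
  count (fun la => num_even_parts la == m) (hook_enum n).

Definition count_even_head (b : bool) (n m : nat) : nat :=
  count (fun la => (odd (head 0 la) == b) && (num_even_parts la == m))
    (hook_enum n).

Lemma A_count_even n m : A n m = count_even n m.
Proof.
rewrite (@A_size n m [seq la <- hook_enum n | num_even_parts la == m]).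
- by rewrite size_filter.
- by rewrite filter_uniq ?hook_enum_uniq.
- by move=> la; rewrite mem_filter mem_hook_enum andbC.
Qed.

Lemma count_even_split n m :
  count_even n m = count_even_head true n m + count_even_head false n m.
Proof.
rewrite /count_even /count_even_head; elim: (hook_enum n) => //= la s ->.
by case: (odd _); case: (_ == m) => //=; lia.
Qed.

Lemma count_even_head_even0 n : count_even_head false n 0 = 0.
Proof.
apply/eqP; rewrite -leqn0 leqNgt -has_count; apply/hasPn => la.
rewrite mem_hook_enum; case: la => [|p la _]; first by rewrite /in_H.
by rewrite /num_even_parts /=; case: (odd p).
Qed.

(** An odd largest part comes from repeating an odd one, with no new even part, or from raising an
    even one, with one even part lost. *)
Lemma count_even_head_oddSS n m :
  count_even_head true n.+2 m =
    count_even_head true n.+1 m + count_even_head false n.+1 m.+1.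
Proof.
rewrite /count_even_head hook_enumSS count_cat !count_map.
congr (_ + _); apply: eq_in_count => -[|p q]; rewrite mem_hook_enum ?/in_H //= => _.
  by rewrite /num_even_parts /=; case: (odd p).
by rewrite /num_even_parts /=; case: (odd p).
Qed.

(** Repeating an even largest part and raising an odd one each add one even part, so every partition
    of the previous level contributes exactly once. *)
Lemma count_even_head_evenSS n m :
  count_even_head false n.+2 m.+1 = count_even n.+1 m.
Proof.
rewrite count_even_split addnC /count_even_head hook_enumSS count_cat !count_map.
congr (_ + _); apply: eq_in_count => -[|p q]; rewrite mem_hook_enum ?/in_H //= => _.
  by rewrite /num_even_parts /=; case: (odd p).
by rewrite /num_even_parts /=; case: (odd p).
Qed.

(** The odd-headed count at n + 2 is the total minus the even-headed count, which is A(n+1, m) by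
    [count_even_head_evenSS]. This subtracted term stands on the left to stay within the
    naturals. *)
Lemma A_rec n m :
  A n.+3 m.+1 + A n.+1 m = A n.+2 m.+1 + A n.+1 m.+1 + A n.+2 m.
Proof.
rewrite !A_count_even [count_even n.+3 _]count_even_split.
rewrite [count_even n.+2 m.+1]count_even_split count_even_head_oddSS.
by rewrite !count_even_head_evenSS; lia.
Qed.

Lemma A_rec0 n : A n.+3 0 = A n.+2 0 + A n.+1 0.
Proof.
rewrite !A_count_even [count_even n.+3 _]count_even_split.
rewrite [count_even n.+2 0]count_even_split count_even_head_oddSS.
by rewrite !count_even_head_evenSS !count_even_head_even0; lia.
Qed.

(** * The closed form of A as a diagonal sum of binomial products *)

Definition diag_sum (k M : nat) : nat :=
  \sum_(j < M.+1) 'C(k + j, j) * 'C(M - j, j).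

Definition diag_step (k M : nat) : nat :=
  \sum_(i < M) 'C(k.+1 + i, i) * 'C(M.-1 - i, i.+1).

Lemma diag_sumE k M :
  diag_sum k M = 1 + \sum_(i < M) 'C(k + i.+1, i.+1) * 'C(M.-1 - i, i.+1).
Proof.
rewrite /diag_sum big_ord_recl /= !bin0; congr (_ + _).
by apply: eq_bigr => i _; rewrite /bump /= ?add1n; congr (_ * 'C(_, _)); lia.
Qed.

Lemma diag_sumS k M : diag_sum k.+1 M = diag_sum k M + diag_step k M.
Proof.
rewrite !diag_sumE -addnA /diag_step -big_split; congr (_ + _).
apply: eq_bigr => i _; rewrite /= -mulnDl; congr (_ * _).
by rewrite addSn binS addnS addSn.
Qed.

Lemma sum_bin_pascal (f : nat -> nat) M :
  \sum_(i < M.+2) f i * 'C(M.+1 - i, i.+1) =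
    \sum_(i < M.+1) f i * 'C(M - i, i.+1) + \sum_(i < M.+1) f i * 'C(M - i, i).
Proof.
rewrite big_ord_recr /= subnn bin0n muln0 addn0 -big_split.
apply: eq_bigr => i _; have le_iM : i <= M by rewrite -ltnS.
by rewrite /= subSn // binS mulnDr.
Qed.

Lemma diag_stepSS k M : diag_step k M.+2 = diag_step k M.+1 + diag_sum k.+1 M.
Proof. exact: (sum_bin_pascal (fun i => 'C(k.+1 + i, i))). Qed.

Lemma diag_sum0SS M : diag_sum 0 M.+2 = diag_sum 0 M.+1 + diag_sum 0 M.
Proof.
rewrite !(diag_sumE 0 _.+1) -addnA (sum_bin_pascal (fun i => 'C(0 + i.+1, i.+1))).
congr (_ + (_ + _)); apply: eq_bigr => i _; by rewrite !add0n !binn.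
Qed.

(** Pascal's rule is used twice: on the first binomial in [diag_sumS], on the second in
    [diag_stepSS]. Eliminating [diag_step] leaves the recurrence of A. *)
Lemma diag_sum_rec k M :
  diag_sum k.+1 M.+2 + diag_sum k M.+1 =
    diag_sum k.+1 M.+1 + diag_sum k.+1 M + diag_sum k M.+2.
Proof. by rewrite !diag_sumS diag_stepSS diag_sumS; lia. Qed.

Lemma diag_sum_0 k : diag_sum k 0 = 1.
Proof. by rewrite diag_sumE big_ord0. Qed.

Lemma diag_sum_1 k : diag_sum k 1 = 1.
Proof. by rewrite diag_sumE big_ord1 /= muln0. Qed.

(** With n = N + 1, the substitution k = m + j identifies this with the sum over k of C(k, m)
    C(n-1-k, k-m). The recurrence has order two, so the induction carries two consecutive levels. *)
Lemma A_diag_sum N m : A N.+1 m = if m <= N then diag_sum m (N - m) else 0.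
Proof.
have [] : (forall m, A N.+1 m = if m <= N then diag_sum m (N - m) else 0) /\
          (forall m, A N.+2 m = if m <= N.+1 then diag_sum m (N.+1 - m) else 0).
  elim: N => [|N [IHN IHN1]].
    by split=> -[|[|i]]; rewrite A_count_even // ?subn0 ?subnn ?diag_sum_0 ?diag_sum_1.
  split=> // -[|i].
    by rewrite A_rec0 IHN IHN1 !subn0 /= diag_sum0SS.
  apply/eqP; rewrite -(eqn_add2r (A N.+1 i)) A_rec !IHN !IHN1 !ltnS.
  case: (ltngtP i N.+1) => [lt_iN|lt_Ni|->]; first 1 last.
  - by rewrite !ifF //; lia.
  - by rewrite !subnn ltnn (ltnNge N.+1) leqnSn /= !diag_sum_0.
  case: (ltngtP i N) => [{}lt_iN|lt_Ni|->]; first 1 last.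
  - by move: lt_iN; rewrite ltnS leqNgt lt_Ni.
  - by rewrite ?subSnn ?subnn ?diag_sum_0 ?diag_sum_1.
  have [M ->] : exists M, N = (M + i).+1 by exists (N - i.+1); lia.
  by rewrite !subSS -!addSn !addnK diag_sum_rec.
by move=> + _; apply.
Qed.

(** * Consecutive differences as sums with a rational parameter *)

Local Open Scope ring_scope.

(** This is the binomial coefficient C(x+1+j, j), read as a polynomial in x. *)
Definition weight (x : rat) (j : nat) : rat :=
  \prod_(i < j) ((x + i.+2%:R) / i.+1%:R).

Definition diff_coef (M j : nat) : rat := 'C(M - j, j)%:R / j.+1%:R.

Definition diff_sum (x : rat) (M : nat) : rat :=
  \sum_(j < M.+1) (3 * j%:R + 1 - M%:R) * (diff_coef M j * weight x j).

Lemma weightS x j : weight x j.+1 = weight x j * ((x + j.+2%:R) / j.+1%:R).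
Proof. by rewrite /weight big_ord_recr. Qed.

Lemma weight0 x : weight x 0 = 1.
Proof. by rewrite /weight big_ord0. Qed.

Lemma weight_gt0 x j : - 2 < x -> 0 < weight x j.
Proof.
move=> x_gt; apply: prodr_gt0 => i _; apply: divr_gt0; last by rewrite ltr0n.
by rewrite -natr1 -natr1; have := ler0n rat i; lra.
Qed.

Lemma weight_nat k j : weight k%:R j = 'C(k.+1 + j, j)%:R.
Proof.
elim: j => [|j IHj]; first by rewrite weight0 bin0.
rewrite weightS IHj; apply: (mulIf (_ : j.+1%:R != 0 :> rat)); first by rewrite pnatr_eq0.
rewrite -mulrA divfK ?pnatr_eq0 // -natrD -!natrM; congr _%:R.
have bin_diag := mul_bin_diag (k.+1 + j).+1 j.
by rewrite (addnS k.+1) [RHS]mulnC -bin_diag mulnC; congr (_ * _)%N; lia.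
Qed.

Lemma diff_coef_ge0 M j : 0 <= diff_coef M j.
Proof. by rewrite divr_ge0 ?ler0n. Qed.

Lemma diff_coef_eq0 M j : (M < 2 * j)%N -> diff_coef M j = 0.
Proof. by move=> lt_Mj; rewrite /diff_coef bin_small ?mul0r //; lia. Qed.

(** Since (j+1) C(M-j, j+1) = (M-2j) C(M-j, j), the linear factor is (j+1) - (M-2j). *)
Lemma diff_coefE M j : (j <= M)%N ->
  (3 * j%:R + 1 - M%:R) * diff_coef M j = 'C(M - j, j)%:R - 'C(M - j, j.+1)%:R.
Proof.
move=> le_jM; have j1 : j.+1%:R != 0 :> rat by rewrite pnatr_eq0.
have bin_left : j.+1%:R * 'C(M - j, j.+1)%:R = (M - j - j)%:R * 'C(M - j, j)%:R :> rat.
  by rewrite -!natrM mul_bin_left.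
apply: (mulIf j1); rewrite /diff_coef mulrA divfK // [RHS]mulrBl.
rewrite ['C(_, j.+1)%:R * _]mulrC bin_left.
have [lt_Mj|le_jMj] := ltnP (M - j) j; first by rewrite bin_small // !(mul0r, mulr0) subrr.
by rewrite !natrB // -natr1; ring.
Qed.

(** The two sums have different weights. Pascal's rule rewrites their difference as one of two sums
    sharing the weight C(k+1+j, j), which can be subtracted termwise. *)
Lemma diag_sum_diff k M :
  (diag_sum k M.+1)%:R - (diag_sum k.+1 M)%:R = diff_sum k%:R M.+1.
Proof.
pose f i := 'C(k.+1 + i, i).
have E : (diag_sum k M.+1 + \sum_(i < M.+2) f i * 'C(M.+1 - i, i.+1) =
          diag_sum k.+1 M.+1 + diag_sum k.+1 M)%N.
  by rewrite sum_bin_pascal (diag_sumS k M.+1) -addnA.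
have {}E := congr1 (fun n => n%:R : rat) E; rewrite !natrD in E.
rewrite (_ : _ - _ = (diag_sum k.+1 M.+1)%:R -
    (\sum_(i < M.+2) f i * 'C(M.+1 - i, i.+1))%:R); last by lra.
rewrite /diag_sum !natr_sum -sumrB /diff_sum; apply: eq_bigr => j _.
rewrite mulrA diff_coefE; last by rewrite -ltnS.
by rewrite weight_nat !natrM mulrBl ![_ * 'C(k.+1 + j, j)%:R]mulrC.
Qed.

(** Each step in j multiplies w_y(j)/w_x(j) by (y+j+2)/(x+j+2) > 1; the claim is
    cross-multiplied. *)
Lemma weight_ratio_homo x y i j : - 2 < x -> x < y -> (i < j)%N ->
  weight y i * weight x j < weight y j * weight x i.
Proof.
move=> x_gt xy; elim: j => [//|j IHj]; rewrite ltnS => le_ij.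
have y_gt : - 2 < y by lra.
have j1 : 0 < j.+1%:R :> rat by rewrite ltr0n.
have wi := @weight_gt0 x i x_gt; have wj := @weight_gt0 y j y_gt.
have j2 : 0 < x + j.+2%:R by rewrite -natr1 -natr1; have := ler0n rat j; lra.
rewrite !weightS [ltRHS]mulrAC !mulrA ltr_pM2r ?invr_gt0 //.
have le_w : weight y i * weight x j <= weight y j * weight x i.
  by move: le_ij; rewrite leq_eqVlt => /predU1P[-> //|/IHj/ltW].
apply: (@le_lt_trans _ _ (weight y j * weight x i * (x + j.+2%:R))).
  by rewrite ler_pM2r.
by rewrite ltr_pM2l ?mulr_gt0 // ltrD2r.
Qed.

Lemma diff_sum_mono x y M : (1 < M)%N -> - 2 < x -> x < y ->
  0 <= diff_sum x M -> 0 < diff_sum y M.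
Proof.
(* The pivot p is the least j with 3j + 1 - M > 0. After scaling so that the weights agree at p, the
   coefficient and the weight difference have compatible signs on both sides of p. *)
move=> M_gt1 x_gt xy Sx; pose p := (M.+2 %/ 3)%N.
have wx j := @weight_gt0 x j x_gt.
have wy j : 0 < weight y j by apply: weight_gt0; lra.
rewrite -(pmulr_rgt0 _ (wx p)).
apply: (@le_lt_trans _ _ (weight y p * diff_sum x M)); first by rewrite mulr_ge0 // ltW.
rewrite /diff_sum !mulr_sumr -subr_gt0 -sumrB.
have term j : weight x p * ((3 * j%:R + 1 - M%:R) * (diff_coef M j * weight y j)) -
    weight y p * ((3 * j%:R + 1 - M%:R) * (diff_coef M j * weight x j)) =
    diff_coef M j * ((3 * j%:R + 1 - M%:R) *
      (weight y j * weight x p - weight y p * weight x j)) by ring.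
(* Strictness comes from the term j = 0, where 1 - M < 0 and p > 0. *)
rewrite big_ord_recl ltr_pwDl //; last first.
  apply: sumr_ge0 => i _; set j := lift _ _; rewrite term mulr_ge0 ?diff_coef_ge0 //.
  have [le_pj|lt_jp] := leqP p j.
    have : (M <= 3 * j + 1)%N by lia.
    rewrite -(ler_nat rat) natrD natrM => le_Mj; apply: mulr_ge0; first by lra.
    rewrite subr_ge0; move: le_pj; rewrite leq_eqVlt => /predU1P[-> //|lt_pj].
    exact/ltW/weight_ratio_homo.
  have : (3 * j + 1 <= M)%N by lia.
  rewrite -(ler_nat rat) natrD natrM => le_jM; apply: mulr_le0; first by lra.
  by rewrite subr_le0 ltW ?weight_ratio_homo.
rewrite term pmulr_rgt0; last by rewrite /diff_coef bin0 divr1.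
have : (0 < p)%N by lia.
move/(weight_ratio_homo _ _ _ _ x_gt xy) => lt_w.
rewrite nmulr_rgt0; first by rewrite subr_lt0.
by move: M_gt1; rewrite -(ltr_nat rat) /=; lra.
Qed.

(** * Term ratios and telescoping certificates *)

Lemma bin_down2 n j :
  j.+1%:R * n%:R * 'C(n.-1, j.+1)%:R =
    (n%:R - j%:R - 1) * (n%:R - j%:R) * 'C(n, j)%:R :> rat.
Proof.
have [lt_nj|le_jn] := ltnP n j; first by rewrite !bin_small ?mulr0 //; lia.
rewrite -mulrA -[n%:R * _]natrM mul_bin_down natrM mulrCA -[j.+1%:R * _]natrM.
rewrite mul_bin_left natrM (natrB _ le_jn).
have [lt_jn|ge_jn] := ltnP j n; first by rewrite natrB // -natr1; ring.
have -> : n = j by apply/eqP; rewrite eqn_leq ge_jn le_jn.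
by rewrite subrr !(mul0r, mulr0).
Qed.

Lemma weight_step x j :
  weight x j.+1 * (3 * (j%:R + 1)) = weight x j * (3 * x + 3 * j%:R + 6).
Proof.
have j1 : j%:R + 1 != 0 :> rat by rewrite natr1 pnatr_eq0.
by rewrite weightS -!natr1; field.
Qed.

(** Passing from j to j + 1 in C(M-j, j) lowers the upper index and raises the lower one, which is
    [bin_down2] at n = M - j. *)
Lemma diff_coef_step M j : (j <= M)%N ->
  diff_coef M j.+1 * ((j%:R + 2) * (M%:R - j%:R)) =
    diff_coef M j * ((M%:R - 2 * j%:R) * (M%:R - 2 * j%:R - 1)).
Proof.
move=> le_jM; have := bin_down2 (M - j) j.
rewrite natrB // /diff_coef subnS -!natr1 => bin_down2.
have j0 := ler0n rat j.
have j1 : j%:R + 1 != 0 :> rat by lra.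
have j2 : j%:R + 1 + 1 != 0 :> rat by lra.
apply: (mulfI j1); move: bin_down2; set a := 'C(_, j.+1)%:R; set b := 'C(_, j)%:R => bin_down2.
transitivity ((j%:R + 1) * (M%:R - j%:R) * a); first by field.
by rewrite bin_down2; field.
Qed.

(** This is [diff_coef] with the factor M + 1 - 2j divided out, in a form that still makes sense at
    2j = M + 1, where it does not vanish. *)
Definition reduced_coef (M j : nat) : rat :=
  'C(M.+1 - j, j)%:R / ((j%:R + 1) * (M%:R + 1 - j%:R)).

Lemma reduced_coefE M j : (j <= M)%N ->
  diff_coef M j = (M%:R + 1 - 2 * j%:R) * reduced_coef M j.
Proof.
move=> le_jM; have j0 := ler0n rat j.
have jM : j%:R <= M%:R :> rat by rewrite ler_nat.
have j1 : j%:R + 1 != 0 :> rat by lra.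
have j2 : M%:R + 1 - j%:R != 0 :> rat by lra.
have [lt_Mj|le_jMj] := ltnP (M.+1 - j) j.
  by rewrite /diff_coef /reduced_coef !bin_small ?(mul0r, mulr0) //; lia.
have := congr1 (fun n => n%:R : rat) (mul_bin_down (M.+1 - j) j).
rewrite /diff_coef /reduced_coef !natrM !natrB ?leqW // -natr1 subSn //= -natr1.
set a := 'C(M - j, j)%:R; set b := 'C((_ - _).+1, j)%:R => bin_down.
apply: (mulfI j2); transitivity ((M%:R + 1 - j%:R) * a / (j%:R + 1)); first by field.
by rewrite bin_down; field; apply/andP.
Qed.

Lemma reduced_coef_step M j : (j < M)%N ->
  reduced_coef M j.+1 * ((j%:R + 2) * (M%:R - j%:R)) =
    reduced_coef M j * ((M%:R - 2 * j%:R) * (M%:R - 2 * j%:R + 1)).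
Proof.
move=> lt_jM; have j0 := ler0n rat j.
have jM : j%:R + 1 <= M%:R :> rat by rewrite natr1 ler_nat.
have := bin_down2 (M.+1 - j) j.
rewrite subSn 1?ltnW // -!natr1 natrB 1?ltnW // /reduced_coef subSS -!natr1 subSn 1?ltnW //=.
set a := 'C(_, j.+1)%:R; set b := 'C(_, j)%:R => bin_down2.
have j1 : j%:R + 1 != 0 :> rat by lra.
have j2 : j%:R + 1 + 1 != 0 :> rat by lra.
have j3 : M%:R - j%:R + 1 != 0 :> rat by lra.
have j4 : M%:R + 1 - j%:R != 0 :> rat by lra.
have j5 : M%:R - j%:R != 0 :> rat by lra.
have j6 : M%:R + 1 - (j%:R + 1) != 0 :> rat by lra.
have -> : b / ((j%:R + 1) * (M%:R + 1 - j%:R)) *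
   ((M%:R - 2 * j%:R) * (M%:R - 2 * j%:R + 1)) =
   (M%:R - j%:R + 1 - j%:R - 1) * (M%:R - j%:R + 1 - j%:R) * b /
   ((j%:R + 1) * (M%:R + 1 - j%:R)) by field; apply/andP.
by rewrite -bin_down2; field; do ?[apply/andP; split].
Qed.

(* With t_j the summand of diff_sum without its factor u = 3j + 1 - m, the
   coefficients of pos_q are the solution of the linear system which makes the
   terms of degree 1, 2, 3 in u vanish in pos_rest. *)
Definition pos_q (m u : rat) : rat :=
  900 * m ^+ 4 + 1944 * m ^+ 3 + 864 * m ^+ 2 - 576 * m + 270 +
  (360 * m ^+ 3 - 1854 * m ^+ 2 - 3708 * m - 630) * u +
  (594 * m ^+ 2 + 1008 * m + 135) * u ^+ 2.

Definition pos_scale (m : rat) : rat :=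
  1000 * m ^+ 6 + 4288 * m ^+ 5 + 4372 * m ^+ 4 - 740 * m ^+ 3 -
  577 * m ^+ 2 + 2015 * m + 550.

Definition pos_c0 (m : rat) : rat :=
  40 * m ^+ 6 - 200 * m ^+ 5 - 1016 * m ^+ 4 - 694 * m ^+ 3 +
  704 * m ^+ 2 + 746 * m + 420.

Definition pos_c4 (m : rat) : rat :=
  464 * m ^+ 3 + 1200 * m ^+ 2 + 1024 * m + 55.

Definition pos_c5 (m : rat) : rat := 330 * m ^+ 2 + 560 * m + 75.

Definition pos_rest (m u : rat) : rat :=
  pos_c0 m + u ^+ 4 * (pos_c4 m + pos_c5 m * u).

(** Here x stands for the index j, and the hypothesis is the term ratio for weight parameter (m-3)/3
    with denominators cleared. Eliminating t' leaves a polynomial identity. *)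
Lemma pos_cert (m x t t' : rat) (u := 3 * x + 1 - m) :
  t' * ((x + 2) * (m - x) * (3 * (x + 1))) =
    t * ((m - 2 * x) * (m - 2 * x - 1) * (m + 3 + 3 * x)) ->
  pos_scale m * (u * t) = pos_rest m u * t -
    (3 * (x + 1) * (x + 2) * (m - x) * pos_q m (u + 3) * t' -
     3 * x * (x + 1) * (m + 1 - x) * pos_q m u * t).
Proof.
move=> step.
transitivity (pos_rest m u * t -
  (pos_q m (u + 3) * (t' * ((x + 2) * (m - x) * (3 * (x + 1)))) -
   3 * x * (x + 1) * (m + 1 - x) * pos_q m u * t)); last first.
  by move: (pos_q m (u + 3)) (pos_q m u) (pos_rest m u) => q q' r; ring.
rewrite step /pos_scale /pos_rest /pos_c0 /pos_c4 /pos_c5 /pos_q /u; ring.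
Qed.

Lemma pos_scale_gt0 m : 9 <= m -> 0 < pos_scale m.
Proof.
move=> m9; have [t t0 ->] : exists2 t : rat, 0 <= t & m = t + 9.
  by exists (m - 9); [lra | ring].
have := exprn_ge0 2 t0; have := exprn_ge0 3 t0; have := exprn_ge0 4 t0.
by have := exprn_ge0 5 t0; have := exprn_ge0 6 t0; rewrite /pos_scale; lra.
Qed.

(** The value 1 - m is that of u at j = 0. The bound 9 comes from [pos_c0], which is negative at m =
    8. In powers of t = m - 9 the inequalities become linear facts about nonnegative monomials. *)
Lemma pos_coef_ge0 m : 9 <= m ->
  [/\ 0 < pos_c0 m, 0 <= pos_c4 m + pos_c5 m * (1 - m) & 0 <= pos_c5 m].
Proof.
move=> m9; have [t t0 ->] : exists2 t : rat, 0 <= t & m = t + 9.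
  by exists (m - 9); [lra | ring].
have := exprn_ge0 2 t0; have := exprn_ge0 3 t0; have := exprn_ge0 4 t0.
have := exprn_ge0 5 t0; have := exprn_ge0 6 t0.
by rewrite /pos_c0 /pos_c4 /pos_c5; split; lra.
Qed.

Lemma pos_rest_gt0 m x : 9 <= m -> 0 <= x -> 0 < pos_rest m (3 * x + 1 - m).
Proof.
move=> m9 x0; have [c0 c45 c5] := pos_coef_ge0 _ m9.
apply: (ltr_wpDr _ c0) => {c0}; apply: mulr_ge0; first by rewrite exprn_even_ge0.
move: (pos_c4 m) (pos_c5 m) c45 c5 => a b c45 c5.
rewrite (_ : a + _ = a + b * (1 - m) + b * (3 * x)); last by ring.
by rewrite addr_ge0 // !mulr_ge0.
Qed.

(* Same construction, with the term t_j / (m + 1 - 2j), which reverses the sign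
   of the residual polynomial. The large coefficients are split because
   literals are unary numbers. *)
Definition neg_q (m u : rat) : rat :=
  (1440 * m ^+ 4 + (7 * 1000 + 335) * m ^+ 3 + (26 * 1000 + 946) * m ^+ 2 +
   (55 * 1000 + 881) * m + (45 * 1000 + 450)) * u +
  (126 * m ^+ 3 - 2268 * m ^+ 2 - (8 * 1000 + 559) * m - (9 * 1000 + 225)) * u ^+ 2 -
  900 * m ^+ 5 - (9 * 1000 + 864) * m ^+ 4 - (40 * 1000 + 887) * m ^+ 3 -
  (90 * 1000 + 306) * m ^+ 2 - (101 * 1000 + 835) * m - (53 * 1000 + 640).

Definition neg_scale (m : rat) : rat :=
  3000 * m ^+ 6 + (22 * 1000 + 824) * m ^+ 5 + (76 * 1000 + 644) * m ^+ 4 + (134 * 1000 + 508) * m ^+ 3 +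
  (121 * 1000 + 383) * m ^+ 2 + (83 * 1000 + 601) * m + (39 * 1000 + 180).

Definition neg_c0 (m : rat) : rat :=
  60 * m ^+ 7 - 222 * m ^+ 6 - (7 * 1000 + 326) * m ^+ 5 - (37 * 1000 + 632) * m ^+ 4 -
  (84 * 1000 + 669) * m ^+ 3 - (111 * 1000 + 906) * m ^+ 2 - (103 * 1000 + 935) * m - (48 * 1000 + 30).

Definition neg_c4 (m : rat) : rat :=
  856 * m ^+ 4 + 3221 * m ^+ 3 + (8 * 1000 + 394) * m ^+ 2 + (16 * 1000 + 484) * m + (13 * 1000 + 975).

Definition neg_c5 (m : rat) : rat :=
  70 * m ^+ 3 - 1260 * m ^+ 2 - 4755 * m - (5 * 1000 + 125).

Definition neg_rest (m u : rat) : rat :=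
  neg_c0 m + u ^+ 4 * (neg_c4 m + neg_c5 m * u).

Lemma neg_cert (m x t t' : rat) (u := 3 * x + 1 - m) :
  t' * ((x + 2) * (m - x) * (3 * (x + 1))) =
    t * ((m - 2 * x) * (m - 2 * x + 1) * (m + 2 + 3 * x)) ->
  neg_scale m * - (u * ((m + 1 - 2 * x) * t)) = neg_rest m u * t -
    (3 * (x + 1) * (x + 2) * (m - x) * neg_q m (u + 3) * t' -
     3 * x * (x + 1) * (m + 1 - x) * neg_q m u * t).
Proof.
move=> step.
transitivity (neg_rest m u * t -
  (neg_q m (u + 3) * (t' * ((x + 2) * (m - x) * (3 * (x + 1)))) -
   3 * x * (x + 1) * (m + 1 - x) * neg_q m u * t)); last first.
  by move: (neg_q m (u + 3)) (neg_q m u) (neg_rest m u) => q q' r; ring.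
rewrite step /neg_scale /neg_rest /neg_c0 /neg_c4 /neg_c5 /neg_q /u; ring.
Qed.

Lemma neg_scale_gt0 m : 0 <= m -> 0 < neg_scale m.
Proof.
move=> m0; have := exprn_ge0 2 m0; have := exprn_ge0 3 m0; have := exprn_ge0 4 m0.
by have := exprn_ge0 5 m0; have := exprn_ge0 6 m0; rewrite /neg_scale; lra.
Qed.

(** Both ends of the range 0 <= j <= (m+1)/2 are examined, u being 1 - m and (m+5)/2 there, because
    [neg_c5] changes sign beyond m = 16. The bound 16 comes from [neg_c0], negative at m = 15. *)
Lemma neg_coef_ge0 m : 16 <= m ->
  [/\ 0 < neg_c0 m, 0 <= neg_c4 m + neg_c5 m * (1 - m) &
      0 <= 2 * neg_c4 m + neg_c5 m * (m + 5)].
Proof.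
move=> m16; have [t t0 ->] : exists2 t : rat, 0 <= t & m = t + 16.
  by exists (m - 16); [lra | ring].
have := exprn_ge0 2 t0; have := exprn_ge0 3 t0; have := exprn_ge0 4 t0.
have := exprn_ge0 5 t0; have := exprn_ge0 6 t0; have := exprn_ge0 7 t0.
by rewrite /neg_c0 /neg_c4 /neg_c5; split; lra.
Qed.

Lemma neg_rest_gt0 m x : 16 <= m -> 0 <= x -> 2 * x <= m + 1 ->
  0 < neg_rest m (3 * x + 1 - m).
Proof.
move=> m16 x0 xm; have m1 : 0 < m + 1 by lra.
have [c0 lo hi] := neg_coef_ge0 _ m16.
apply: (ltr_wpDr _ c0) => {c0}; apply: mulr_ge0; first by rewrite exprn_even_ge0.
move: (neg_c4 m) (neg_c5 m) lo hi => a b lo hi.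
(* An affine function of x, nonnegative at x = 0 and at x = (m + 1) / 2. *)
rewrite -(pmulr_rge0 _ m1).
rewrite (_ : _ * _ = (m + 1 - 2 * x) * (a + b * (1 - m)) +
  x * (2 * a + b * (m + 5))); last by ring.
by rewrite addr_ge0 // mulr_ge0 // subr_ge0.
Qed.

(** The bracket is G(j+1) - G(j), where G(0) = 0 by its factor j and G(M+1) = 0 by T(M+1) = 0. Hence
    c times the sum of f is the sum of r T, whose term at 0 is positive. The sign of r matters only
    on the support of T. *)
Lemma telescoped_sum_gt0 M (c : rat) (q r : rat -> rat) (f T : nat -> rat) :
    0 < c -> 0 < T 0 -> T M.+1 = 0 ->
    (forall j, (j <= M)%N -> 0 <= T j) ->
    (forall j, (j <= M)%N -> T j != 0 -> 0 < r (3 * j%:R + 1 - M%:R)) ->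
    (forall j, (j <= M)%N ->
       c * f j = r (3 * j%:R + 1 - M%:R) * T j -
         (3 * (j%:R + 1) * (j%:R + 2) * (M%:R - j%:R) *
            q (3 * j%:R + 1 - M%:R + 3) * T j.+1 -
          3 * j%:R * (j%:R + 1) * (M%:R + 1 - j%:R) *
            q (3 * j%:R + 1 - M%:R) * T j)) ->
  0 < \sum_(j < M.+1) f j.
Proof.
move=> c0 T0 TM T_ge0 r_gt0 cert.
pose G j := 3 * j%:R * (j%:R + 1) * (M%:R + 1 - j%:R) *
  q (3 * j%:R + 1 - M%:R) * T j.
have term (j : 'I_M.+1) :
    c * f j = r (3 * j%:R + 1 - M%:R) * T j - (G j.+1 - G j).
  rewrite cert -1?ltnS // /G -[j.+1%:R]natr1.
  rewrite (_ : 3 * (j%:R + 1) + 1 - M%:R = 3 * j%:R + 1 - M%:R + 3); last by ring.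
  by ring.
rewrite -(pmulr_rgt0 _ c0) mulr_sumr (eq_bigr _ (fun j _ => term j)).
rewrite sumrB -(big_mkord xpredT (fun j => G j.+1 - G j)) telescope_sumr //.
rewrite {1}/G /G TM !(mulr0, mul0r) !subr0 big_ord_recl ltr_pwDl //.
  by rewrite mulr_gt0 // r_gt0 // gt_eqF.
apply: sumr_ge0 => i _; set j := lift _ _.
have le_jM : (j <= M)%N by rewrite -ltnS.
have [->|Tj] := eqVneq (T j) 0; first by rewrite mulr0.
by rewrite mulr_ge0 ?T_ge0 // ltW // r_gt0.
Qed.

(** * Signs at the two critical parameters *)

Lemma diff_sum_gt0_large M : (9 <= M)%N -> 0 < diff_sum ((M%:R - 3) / 3) M.
Proof.
move=> M9; have m9 : 9 <= M%:R :> rat by rewrite (ler_nat _ 9).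
set x := _ / 3; pose T j := diff_coef M j * weight x j.
have wx j : 0 < weight x j by apply: weight_gt0; rewrite /x; lra.
apply: (telescoped_sum_gt0 M (pos_scale M%:R) (pos_q M%:R) (pos_rest M%:R)
  (fun j => (3 * j%:R + 1 - M%:R) * T j) T).
- exact: pos_scale_gt0.
- by rewrite mulr_gt0 // /diff_coef bin0 divr1.
- by rewrite /T diff_coef_eq0 ?mul0r //; lia.
- by move=> j _; rewrite mulr_ge0 ?diff_coef_ge0 // ltW.
- by move=> j _ _; apply: pos_rest_gt0.
move=> j le_jM; apply: pos_cert.
rewrite /T mulrACA diff_coef_step // weight_step mulrACA.
by congr (_ * (_ * _)); rewrite /x; field.
Qed.

Lemma diff_sum_lt0_large M : (16 <= M)%N -> diff_sum ((M%:R - 4) / 3) M < 0.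
Proof.
move=> M16; have m16 : 16 <= M%:R :> rat by rewrite (ler_nat _ 16).
set x := _ / 3; pose T j := reduced_coef M j * weight x j.
have wx j : 0 < weight x j by apply: weight_gt0; rewrite /x; lra.
have T_small j : (M.+1 < 2 * j)%N -> T j = 0.
  by move=> lt_Mj; rewrite /T /reduced_coef bin_small ?mul0r //; lia.
pose f j := - ((3 * j%:R + 1 - M%:R) * ((M%:R + 1 - 2 * j%:R) * T j)).
rewrite -oppr_gt0 -sumrN (eq_bigr (fun j : 'I_M.+1 => f j)); last first.
  move=> j _; have le_jM : (j <= M)%N by rewrite -ltnS.
  by rewrite /f /T reduced_coefE // -!mulrA.
apply: (telescoped_sum_gt0 M (neg_scale M%:R) (neg_q M%:R) (neg_rest M%:R) f T).
- by apply: neg_scale_gt0; lra.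
- by rewrite mulr_gt0 // /reduced_coef subn0 bin0 divr_gt0 // mulr_gt0 //; lra.
- by rewrite T_small //; lia.
- move=> j; rewrite -(ler_nat rat) => jM; have j0 := ler0n rat j.
  by rewrite mulr_ge0 ?(ltW (wx j)) // divr_ge0 ?ler0n // mulr_ge0 //; lra.
- move=> j _ Tj; have [/T_small Tj0|] := ltnP M.+1 (2 * j).
    by case/eqP: Tj.
  rewrite -(ler_nat rat) natrM -[M.+1%:R]natr1 => jM.
  by apply: neg_rest_gt0.
move=> j le_jM; apply: neg_cert.
(* The ratio formula requires j < M; at j = M both T(M) and T(M+1) vanish. *)
move: le_jM; rewrite leq_eqVlt => /predU1P[->|lt_jM].
  by rewrite !T_small ?mul0r //; lia.
rewrite /T mulrACA reduced_coef_step // weight_step mulrACA.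
by congr (_ * (_ * _)); rewrite /x; field.
Qed.

Lemma diff_sum_half x M :
  diff_sum x M = \sum_(j < (M./2).+1) (3 * j%:R + 1 - M%:R) *
    (diff_coef M j * weight x j).
Proof.
pose F j := (3 * j%:R + 1 - M%:R) * (diff_coef M j * weight x j).
rewrite /diff_sum -(big_mkord xpredT F) -[RHS](big_mkord xpredT F).
rewrite (big_cat_nat _ (n := (M./2).+1)) //=; last by lia.
rewrite [X in _ + X]big1_seq ?addr0 // => j /andP[_].
rewrite mem_index_iota => /andP[lt_j _].
by rewrite /F diff_coef_eq0 ?mul0r ?mulr0 //; lia.
Qed.

Ltac diff_sum_lra :=
  rewrite diff_sum_half /weight !big_ord_recr !big_ord0 /diff_coef /=;
  cbv [binomial addn subn Nat.add Nat.sub addn_rec subn_rec]; lra.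

Lemma diff_sum_gt0 M : (4 <= M)%N -> 0 < diff_sum ((M%:R - 3) / 3) M.
Proof.
move=> M4; have [/diff_sum_gt0_large //|M9] := leqP 9 M.
have : M \in iota 4 5 by rewrite mem_iota M4.
by rewrite !inE => /or4P[||| /orP[]] => /eqP->; diff_sum_lra.
Qed.

(** The sum is exactly 0 at M = 3, so only the weak inequality extends below 4; it suffices for
    [diff_sum_mono]. *)
Lemma diff_sum_ge0 M : (2 <= M)%N -> 0 <= diff_sum ((M%:R - 3) / 3) M.
Proof.
move=> M2; have [/diff_sum_gt0/ltW //|M4] := leqP 4 M.
have : M \in iota 2 2 by rewrite mem_iota M2.
by rewrite !inE => /orP[] /eqP->; diff_sum_lra.
Qed.

(** At M = 4 the sum is 0, which corresponds to A(5, 0) = A(5, 1). *)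
Lemma diff_sum_lt0 M : (5 <= M)%N -> diff_sum ((M%:R - 4) / 3) M < 0.
Proof.
move=> M5; have [/diff_sum_lt0_large //|M16] := leqP 16 M.
have : M \in iota 5 11 by rewrite mem_iota M5.
rewrite !inE => /or4P[||| /or4P[||| /or4P[||| /orP[]]]] => /eqP->; diff_sum_lra.
Qed.

(** * From the critical parameters to integers, and the conclusion *)

Lemma diff_sum_nat_gt0 k M : (2 <= M <= 3 * k + 3)%N -> (5 <= M + k)%N ->
  0 < diff_sum k%:R M.
Proof.
move=> /andP[M2 Mk] Mk5; have m2 : 2 <= M%:R :> rat by rewrite (ler_nat _ 2).
(* Here k is itself the critical parameter, so strict positivity is required; M + k >= 5 rules out
   the vanishing case M = 3, k = 0. *)
have [def_M|ne_M] := eqVneq M (3 * k + 3)%N.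
  have := @diff_sum_gt0 M ltac:(lia).
  rewrite (_ : (M%:R - 3) / 3 = k%:R) // def_M natrD natrM.
  by field.
have : (M < 3 * k + 3)%N by lia.
rewrite -(ltr_nat rat) natrD natrM => lt_M.
by apply: (diff_sum_mono ((M%:R - 3) / 3)); [|lra|lra|apply: diff_sum_ge0].
Qed.

Lemma diff_sum_nat_lt0 k M : (3 * k + 4 <= M)%N -> (5 <= M)%N ->
  diff_sum k%:R M < 0.
Proof.
move=> Mk M5; have := diff_sum_lt0 _ M5.
have [->|ne_M] := eqVneq M (3 * k + 4)%N.
  rewrite (_ : (_ - 4) / 3 = k%:R) // natrD natrM.
  by field.
have : (3 * k + 4 < M)%N by lia.
rewrite -(ltr_nat rat) natrD natrM => lt_M lt0; have k0 := ler0n rat k.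
rewrite ltNge; apply/negP => ge0.
suff : 0 < diff_sum ((M%:R - 4) / 3) M by rewrite ltNge (ltW lt0).
by apply: diff_sum_mono ge0; [lia|lra|lra].
Qed.

Local Close Scope ring_scope.

Theorem theorem1p1 (n : nat) (hn : 6 <= n) :
  strongly_unimodal (A n) (n - 2) ((n - 1) %/ 4).
Proof.
case: n hn => [//|N] hN.
have diff i M : N = M.+1 + i ->
    [/\ A N.+1 i = diag_sum i M.+1, A N.+1 i.+1 = diag_sum i.+1 M &
        ((diag_sum i M.+1)%:R - (diag_sum i.+1 M)%:R = diff_sum i%:R M.+1)%R].
  move=> ->; split; last exact: diag_sum_diff.
    by rewrite A_diag_sum leq_addl addnK.
  by rewrite A_diag_sum addSnnS leq_addl addnK.
(* The difference at i is [diff_sum] at n - 1 - i. The bound n - 1 - i >= 3i + 4 means i + 1 <=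
   (n-1)/4, that is, i lies before the mode. *)
split=> [|i lt_i|i le_i lt_i]; first by lia.
  have [|-> -> dE] := diff i (N - i.+1); first by lia.
  rewrite -(ltr_nat rat) -subr_lt0 dE diff_sum_nat_lt0 //; lia.
have [|-> -> dE] := diff i (N - i.+1); first by lia.
rewrite -(ltr_nat rat) -subr_gt0 dE diff_sum_nat_gt0 //; lia.
Qed.
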